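(* Let $d\geqslant 1$, let $1\leqslant\gamma_1\leqslant\cdots\leqslant\gamma_{d-1}$ be fixed integers, let $\Gamma=\{1,\gamma_1,\ldots,\gamma_{d-1}\}$ and $c_\Gamma=1+\sum_{i=1}^{d-1}\gamma_i^2$. Let $\tau(C_n^\Gamma)$ be the number of spanning trees of the circulant graph $C_n^\Gamma$, and let $(a_n)$ be a sequence such that $\tau(C_n^\Gamma)=na_n^2$ and $a_n\sim c\,\phi^n$ as $n\to\infty$ for some constants $c$ and $\phi$. Then $$c^2=\frac{1}{c_\Gamma}.$$
   Context: The circulant graph $C_n^\Gamma$ with $\Gamma=\{1,\gamma_1,\ldots,\gamma_{d-1}\}$ (where $\gamma_{d-1}\leqslant\lfloor n/2\rfloor$) is the $2d$-regular graph with vertex set $\mathbb{Z}/n\mathbb{Z}$ in which each vertex $v$ is connected to $v\pm1$ and $v\pm\gamma_i$ mod $n$ for $i=1,\ldots,d-1$ (edges counted with multiplicity). The notation $a_n\sim c\phi^n$ means $a_n/(c\phi^n)\to1$ as $n\to\infty$, with $c,\phi\neq0$. *)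

(* Defs.v *)
From mathcomp Require Import all_boot all_order all_algebra.
From mathcomp Require Import boolp.

Set Implicit Arguments.
Unset Strict Implicit.
Unset Printing Implicit Defensive.

(* Finite undirected multigraphs, loops allowed.  The orientation given to an
   edge by its two ends is only bookkeeping. *)
Record mgraph := MGraph {
  vertex : finType;
  edge : finType;
  end0 : edge -> vertex;
  end1 : edge -> vertex
}.

Section SpanningTrees.
Variable G : mgraph.

Definition adj (T : {set edge G}) : rel (vertex G) :=
  fun x y => [exists e in T, ((end0 e == x) && (end1 e == y))
                          || ((end0 e == y) && (end1 e == x))].

Definition spanning_connected (T : {set edge G}) : Prop :=
  forall x y : vertex G, connect (adj T) x y.

(* A dart (e, b) is the edge e traversed from end0 to end1 if b is true, and
   from end1 to end0 otherwise. *)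
Definition dart_src (a : edge G * bool) : vertex G :=
  if a.2 then end0 a.1 else end1 a.1.
Definition dart_tgt (a : edge G * bool) : vertex G :=
  if a.2 then end1 a.1 else end0 a.1.

(* With this definition a loop is a cycle of length 1, and two parallel edges
   form a cycle of length 2. *)
Definition graph_cycle (s : seq (edge G * bool)) : bool :=
  [&& s != [::],
      cycle (fun a b => dart_tgt a == dart_src b) s,
      uniq [seq a.1 | a <- s] & uniq [seq dart_src a | a <- s]].

Definition acyclic (T : {set edge G}) : Prop :=
  forall s : seq (edge G * bool),
    graph_cycle s -> ~ {subset [seq a.1 | a <- s] <= T}.

Definition spanning_tree (T : {set edge G}) : Prop :=
  spanning_connected T /\ acyclic T.

Definition num_spanning_trees : nat :=
  #|[set T : {set edge G} | `[< spanning_tree T >]]|.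

End SpanningTrees.

(* The circulant graph on Z/nZ whose jumps are the entries of the list Gam,
   repeated entries giving parallel edges.  The edge (v, i) joins v to v + g,
   where g is the i-th jump, so each i contributes one edge towards v + g and
   one towards v - g at every vertex v, even when 2 g = n.  Meaningful only for
   n >= 2, since 'Z_n is Z/2Z for n = 0 and n = 1. *)
Definition circulant (n : nat) (Gam : seq nat) : mgraph :=
  @MGraph 'Z_n ('Z_n * 'I_(size Gam))%type
    (fun e => e.1)
    (fun e => (e.1 + (nth 0%N Gam e.2)%:R)%R).

(* Main.v *)
Require Import Defs.
From mathcomp Require Import all_boot all_order all_algebra.
From mathcomp Require Import all_fingroup all_solvable all_field.
From mathcomp Require Import boolp ring.
Import Order.TTheory GRing.Theory Num.Theory.

(* The number of spanning trees is the determinant of the reduced Laplacian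
   (Cauchy-Binet over families of k = #|V| - 1 edges, the incidence minor of a
   family being 0 or +-1 according to connectedness).  For a circulant graph the
   Laplacian plus the all-ones matrix is diagonalised by the Fourier matrix, so
   n tau_n is the product of lambda(w^k), 0 < k < n, where w is a primitive n-th
   root of unity and lambda(z) = sum_g (1 - z^g)(1 - z^-g).

   Now z^m lambda(z) = - (z - 1)^2 Q(z) with Q(1) = c_Gamma, and Q has no root on
   the unit circle.  With l the leading coefficient and r the roots of Q, this gives
     c_Gamma tau_n = n |l|^n prod_r |1 - r^n|,
   whence c_Gamma tau_n / (n rho^n) --> 1 for rho = |l| prod_r max(1, |r|).
   Comparing with tau_n = n a_n^2 forces phi^2 = rho and c_Gamma c^2 = 1. *)

Set Implicit Arguments.
Unset Strict Implicit.
Unset Printing Implicit Defensive.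

Local Open Scope ring_scope.

(** * Cauchy-Binet for families of columns *)

(* Cauchy-Binet, summed over ordered families instead of k-subsets: every subset
   is counted k! times, and no enumeration of it has to be chosen. *)
Lemma det_mul_family (R : comNzRingType) (k : nat) (E : finType)
    (A B : 'I_k -> E -> R) :
  \det (\matrix_(i, j) \sum_e A i e * B j e) *+ k`! =
  \sum_(f : {ffun 'I_k -> E})
     \det (\matrix_(i, j) A i (f j)) * \det (\matrix_(i, j) B i (f j)).
Proof.
(* For each [s], the expansion of the left side over families is reindexed by composing [f] with
   [s], which permutes the columns of the [B]-minor and gives the sign. Summing over all [s] then
   assembles the [A]-minor. *)
have detE (s : 'S_k) : \det (\matrix_(i, j) \sum_e A i e * B j e) =
    \sum_(f : {ffun 'I_k -> E})
      (-1) ^+ s * \prod_i A i (f (s i)) * \det (\matrix_(i, j) B i (f j)).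
  transitivity (\sum_(f : {ffun 'I_k -> E})
      \prod_i A i (f i) * \det (\matrix_(i, j) B i (f j))).
    rewrite {1}/determinant.
    under eq_bigr => t _.
      under eq_bigr => i _ do rewrite mxE.
      rewrite bigA_distr_bigA /= big_distrr /=; over.
    rewrite exchange_big /=; apply: eq_bigr => f _.
    rewrite -det_tr /determinant big_distrr /=; apply: eq_bigr => t _.
    rewrite big_split /= mulrCA; congr (_ * (_ * _)).
    by apply: eq_bigr => i _; rewrite !mxE.
  have sK : cancel (fun f : {ffun 'I_k -> E} => [ffun i => f (s i)])
                   (fun f : {ffun 'I_k -> E} => [ffun i => f ((s^-1)%g i)]).
    by move=> f; apply/ffunP=> i; rewrite !ffunE permKV.
  have Ks : cancel (fun f : {ffun 'I_k -> E} => [ffun i => f ((s^-1)%g i)])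
                   (fun f : {ffun 'I_k -> E} => [ffun i => f (s i)]).
    by move=> f; apply/ffunP=> i; rewrite !ffunE permK.
  rewrite (reindex (fun f : {ffun 'I_k -> E} => [ffun i => f (s i)])) /=; last first.
    by exists (fun f : {ffun 'I_k -> E} => [ffun i => f ((s^-1)%g i)]) => f _.
  apply: eq_bigr => f _.
  have -> : \matrix_(i, j) B i ([ffun i0 => f (s i0)] j) =
            (\matrix_(i, j) B i (f j)) *m (perm_mx s^-1)%g.
    by rewrite -col_permE; apply/matrixP => i j; rewrite !mxE ffunE.
  rewrite det_mulmx det_perm odd_permV.
  under eq_bigr => i _ do rewrite ffunE.
  by rewrite mulrA mulrC mulrA.
have -> : k`! = #|'S_k| by rewrite card_Sn.
rewrite -sumr_const (eq_bigr _ (fun s _ => detE s)) exchange_big /=.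
apply: eq_bigr => f _; rewrite -big_distrl /=; congr (_ * _).
rewrite /determinant; apply: eq_big => /= [s|s _]; first by rewrite inE.
congr (_ * _).
by apply: eq_bigr => i _; rewrite !mxE.
Qed.

(** * Walks, cycles and signed incidence in a multigraph *)

(** The two terms cancel on a loop, whose column is therefore zero. *)
Definition incidence (R : pzRingType) (G : mgraph) (u : vertex G) (e : edge G) : R :=
  (end1 e == u)%:R - (end0 e == u)%:R.

Section Walks.
Variable G : mgraph.
Implicit Types (T : {set edge G}) (s : seq (edge G * bool)).

Lemma adj_sym T : symmetric (adj T).
Proof. by move=> x y; apply: eq_existsb => e; rewrite orbC. Qed.

Lemma connect_adj_sym T : connect_sym (adj T).
Proof. exact/sym_connect_sym/adj_sym. Qed.

Lemma adj_dart T x y :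
  adj T x y -> exists a, [/\ a.1 \in T, dart_src a = x & dart_tgt a = y].
Proof.
case/existsP=> e /andP[eT /orP[/andP[/eqP <- /eqP <-]|/andP[/eqP <- /eqP <-]]].
  by exists (e, true).
by exists (e, false).
Qed.

Lemma dart_pathE a s :
  path (fun a b => dart_tgt a == dart_src b) a s =
  (map (@dart_tgt G) (belast a s) == map (@dart_src G) s).
Proof. by elim: s a => //= b s IHs a; rewrite eqseq_cons IHs. Qed.

Lemma sum_dart_cycle (M : zmodType) (h : vertex G -> M) s :
  graph_cycle s ->
  \sum_(a <- s) h (dart_tgt a) = \sum_(a <- s) h (dart_src a).
Proof.
case/and4P=> _; case: s => [|a s]; first by rewrite !big_nil.
rewrite /= dart_pathE belast_rcons => /eqP eq_ts _ _.
rewrite -(big_map (@dart_tgt G) xpredT) eq_ts map_rcons -cats1.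
by rewrite big_cat big_seq1 /= big_map addrC big_cons.
Qed.

Lemma path_darts T x p :
    path (adj T) x p -> uniq (x :: p) ->
  exists s, [/\ map (@dart_src G) s = belast x p, map (@dart_tgt G) s = p,
    {subset [seq a.1 | a <- s] <= T} & uniq [seq a.1 | a <- s]].
Proof.
elim: p x => [|y p IHp] x /=; first by exists [::].
case/andP=> /adj_dart[a [aT ax ay]] /IHp{}IHp /andP[x_yp /IHp[s [s_src s_tgt sT us]]].
exists (a :: s); split; rewrite /= ?ax ?ay ?s_src ?s_tgt //.
  by move=> e; rewrite inE => /predU1P[->|/sT].
(* If a later dart [b] reused the edge of [a], then [x], an end of that edge, would be visited
   again. *)
rewrite us andbT; apply: contra x_yp => /mapP[b bs ab].
have bsrc : dart_src b \in y :: p.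
  by apply: mem_belast; rewrite -s_src map_f.
have btgt : dart_tgt b \in y :: p by rewrite inE -s_tgt map_f ?orbT.
by move: ax bsrc btgt; rewrite /dart_src /dart_tgt ab => <-; case: a.2; case: b.2.
Qed.

(** A simple path in [T] from the head of [e] back to its tail is closed up by [e]; for a loop the
    path is empty. *)
Lemma cycle_of_connect T e :
    connect (adj T) (end1 e) (end0 e) -> e \notin T ->
  exists2 s, graph_cycle s & {subset [seq a.1 | a <- s] <= e |: T}.
Proof.
case/connectP=> p0 /shortenP[p pp up _] e0E eT.
have [s [s_src s_tgt sT us]] := path_darts pp up.
exists ((e, true) :: s).
  apply/and4P; split=> //=.
  - rewrite /= dart_pathE belast_rcons map_rcons s_src /= s_tgt.
    by rewrite /dart_src /dart_tgt /= e0E -lastI.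
  - by rewrite us andbT; apply: contra eT => /sT.
  - rewrite s_src -rcons_uniq /dart_src /= e0E -lastI //.
move=> f; rewrite !inE => /predU1P[->|/sT ->]; by rewrite ?eqxx ?orbT.
Qed.

Lemma dart_incidence (R : pzRingType) u (a : edge G * bool) :
  (-1) ^+ (~~ a.2) * incidence R u a.1 = (dart_tgt a == u)%:R - (dart_src a == u)%:R.
Proof.
by case: a => e [] /=; rewrite /incidence ?mul1r ?mulN1r ?opprB.
Qed.

End Walks.

(** * The matrix-tree theorem, with vertex [ord0] deleted *)

Section MatrixTree.
Variables (k : nat) (E : finType) (e0 e1 : E -> 'I_k.+1).
Let G := MGraph e0 e1.

Definition reduced_incidence (R : pzRingType) (i : 'I_k) (e : E) : R :=
  @incidence R G (lift ord0 i) e.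

Section Family.
Variables (I : finType) (f : I -> E).
Let T : {set edge G} := [set f i | i in I].

(** Columns signed by the direction of traversal telescope along a walk. *)
Lemma walk_combination x y : connect (adj T) x y ->
  exists P : I -> int, forall u : vertex G,
    \sum_j incidence int u (f j) * P j = (y == u)%:R - (x == u)%:R.
Proof.
case/connectP=> p; elim: p x => [|z p IHp] x /= => [_ ->|].
  by exists (fun=> 0) => u; rewrite subrr big1 // => j _; rewrite mulr0.
case/andP=> /adj_dart[a [/imsetP[j0 _ aj0] ax az]] /IHp{}IHp /IHp[P hP].
exists (fun j => P j + (j == j0)%:R * (-1) ^+ (~~ a.2)) => u.
under eq_bigr do rewrite mulrDr.
rewrite big_split /= hP (bigD1 j0) //= big1 => [|j /negPf->]; last by rewrite mul0r mulr0.
rewrite eqxx mul1r addr0 -aj0 [X in _ + X]mulrC (@dart_incidence G int) ax az.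
by rewrite addrA subrK.
Qed.

(** Walks start at [ord0], whose row is deleted, so the combination for a walk to [lift ord0 i'] is
    the basis vector of [i']. The index type is left general to cover both families of [k] edges and
    enumerations of a tree. *)
Lemma connected_right_inverse : spanning_connected T ->
  exists P : I -> 'I_k -> int, forall i i',
    \sum_j reduced_incidence int i (f j) * P j i' = (i == i')%:R.
Proof.
move=> conT.
have /fin_all_exists[P hP] (i' : 'I_k) := walk_combination (conT ord0 (lift ord0 i')).
exists (fun j i' => P i' j) => i i'.
by rewrite hP (inj_eq lift_inj) subr0 eq_sym.
Qed.

End Family.

Section Columns.
Variable f : {ffun 'I_k -> E}.
Let T : {set edge G} := [set f i | i in 'I_k].
Let M : 'M[int]_k := \matrix_(i, j) reduced_incidence int i (f j).

(* An integer matrix with an integral right inverse has determinant 1 or -1. *)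
Lemma connected_det_sqr : spanning_connected T -> \det M ^+ 2 = 1.
Proof.
case/connected_right_inverse=> P hP.
have /(congr1 determinant) : M *m \matrix_(i, j) P i j = 1%:M.
  apply/matrixP => i i'; rewrite !mxE -hP.
  by apply: eq_bigr => j _; rewrite !mxE.
rewrite det_mulmx det1 => /(congr1 absz); rewrite abszM absz1 => /eqP.
by rewrite muln_eq1 => /andP[/eqP dM _]; rewrite -[LHS]gez0_abs ?sqr_ge0 // abszX dM.
Qed.

(** The indicator of the vertices not reachable from [ord0] agrees at the two ends of every edge of
    [T], so it is a left null vector of the incidence matrix. It vanishes at [ord0], hence survives
    the deletion of that row. *)
Lemma disconnected_det : ~ spanning_connected T -> \det M = 0.
Proof.
move=> nconT; apply/eqP/det0P.
pose h (v : vertex G) : int := (~~ connect (adj T) ord0 v)%:R.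
have h0 : h ord0 = 0 by rewrite /h connect0.
have [v hv] : exists i : 'I_k, h (lift ord0 i) != 0.
  apply/existsP; apply: contra_notT nconT => /existsPn hP x y.
  have con0 (v : vertex G) : connect (adj T) ord0 v.
    case: (unliftP ord0 v) => [i ->|->]; last exact: connect0.
    by have := hP i; rewrite negbK /h; case: connect.
  by apply: connect_trans (con0 y); rewrite connect_adj_sym.
exists (\row_i h (lift ord0 i)).
  by apply/eqP=> /rowP/(_ v); rewrite !mxE => /eqP; rewrite (negPf hv).
apply/rowP => j; rewrite !mxE.
have sumh (x : vertex G) : \sum_i h (lift ord0 i) * (x == lift ord0 i)%:R = h x.
  transitivity (\sum_v h v * (x == v)%:R).
    by rewrite big_ord_recl h0 mul0r add0r.
  rewrite (bigD1 x) //= eqxx mulr1 big1 ?addr0 // => u.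
  by rewrite eq_sym => /negPf->; rewrite mulr0.
under eq_bigr do rewrite !mxE /reduced_incidence /incidence mulrBr.
rewrite sumrB !sumh /h; apply/eqP; rewrite subr_eq0; apply/eqP.
suff -> : connect (adj T) ord0 (@end1 G (f j)) = connect (adj T) ord0 (@end0 G (f j)) by [].
rewrite ![connect _ ord0 _]connect_adj_sym.
apply: same_connect; first exact: connect_adj_sym.
apply: connect1; apply/existsP; exists (f j).
by rewrite imset_f // !eqxx orbT.
Qed.

(** The signed indicator [w] of the cycle is a null vector of the columns. It is nonzero because a
    cycle uses each of its edges once. *)
Lemma cycle_det (s : seq (edge G * bool)) :
  graph_cycle s -> {subset [seq a.1 | a <- s] <= T} -> injective f -> \det M = 0.
Proof.
move=> cs sT finj; rewrite -det_tr; apply/eqP/det0P.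
pose w (e : edge G) : int := \sum_(a <- s | a.1 == e) (-1) ^+ (~~ a.2).
exists (\row_j w (f j)); last first.
  apply/rowP => i; rewrite !mxE.
  transitivity (\sum_(a <- s) (-1) ^+ (~~ a.2) * @incidence int G (lift ord0 i) a.1).
    under eq_bigr do rewrite !mxE /w mulr_suml.
    rewrite (exchange_big_dep xpredT) //= !big_seq; apply: eq_bigr => a as_.
    have /imsetP[j _ aj] : a.1 \in T by apply: sT; rewrite map_f.
    rewrite (big_pred1 j) ?aj // => j'; rewrite /= eq_sym; exact: inj_eq.
  under eq_bigr do rewrite (@dart_incidence G int).
  rewrite sumrB; apply/eqP; rewrite subr_eq0; apply/eqP.
  exact: (@sum_dart_cycle G int (fun v => (v == lift ord0 i)%:R)).
case/and4P: cs => s0 _ us _; case: s => // a s in s0 sT us w *.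
have /imsetP[j _ aj] : a.1 \in T by apply: sT; rewrite mem_head.
apply/eqP=> /rowP/(_ j)/eqP; rewrite !mxE /w big_cons aj eqxx big_seq_cond big1.
  by rewrite addr0 signr_eq0.
move=> b /andP[bs /eqP bj]; case/andP: us => /negP[].
by rewrite aj -bj map_f.
Qed.

End Columns.

(** A cycle among [k] distinct connecting edges would make a determinant of square 1 vanish. *)
Lemma spanning_tree_family (f : {ffun 'I_k -> E}) : injective f ->
  @spanning_tree G [set f i | i in 'I_k] <->
  @spanning_connected G [set f i | i in 'I_k].
Proof.
move=> finj; split=> [[]//|con]; split=> // s cs sT.
by have := connected_det_sqr con; rewrite (cycle_det cs sT finj) expr0n.
Qed.

(** The columns of a tree have rank [k], so some [k] of them have nonzero determinant, and those
    edges already connect the graph. Any further edge of the tree would close a cycle with them. *)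
Lemma spanning_tree_card (T : {set edge G}) : spanning_tree T -> #|T| = k.
Proof.
case=> conT acT.
pose g (j : 'I_#|T|) : E := enum_val j.
have gT : [set g j | j in 'I_#|T|] = T.
  apply/setP => e; apply/imsetP/idP => [[j _ ->]|eT]; first exact: enum_valP.
  by exists (enum_rank_in eT e); rewrite // /g enum_rankK_in.
have [P hP] : exists P : 'I_#|T| -> 'I_k -> int, forall i i',
    \sum_j reduced_incidence int i (g j) * P j i' = (i == i')%:R.
  by apply: connected_right_inverse; rewrite gT.
pose N : 'M[rat]_(#|T|, k) := \matrix_(j, i) (reduced_incidence int i (g j))%:~R.
have fullN : row_full N.
  apply/row_fullP; exists (\matrix_(i, j) (P j i)%:~R).
  apply/matrixP => i i'; rewrite !mxE eq_sym.
  transitivity ((i' == i)%:R%:~R : rat); last by rewrite eq_sym; case: eqP.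
  rewrite -hP rmorph_sum /=; apply: eq_bigr => j _.
  by rewrite !mxE rmorphM /= mulrC.
have [F Finj Ffull] : exists2 F : {ffun 'I_k -> 'I_#|T|},
    injective F & row_full (rowsub F N).
  exists (fullrankfun fullN); [exact: fullrankfun_inj | exact: fullrowsub_full].
pose f : {ffun 'I_k -> E} := [ffun i => g (F i)].
have finj : injective f.
  by move=> i j; rewrite !ffunE => /enum_val_inj/Finj.
have detf : \det (\matrix_(i, j) reduced_incidence int i (f j)) != 0.
  move: Ffull; rewrite row_full_unit unitmxE unitfE.
  apply: contraNneq => d0; rewrite -det_tr.
  transitivity ((\det (\matrix_(i, j) reduced_incidence int i (f j)))%:~R == 0 :> rat).
    rewrite -det_map_mx; congr (\det _ == _).
    by apply/matrixP => i j; rewrite !mxE ffunE.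
  by rewrite d0.
have conf : @spanning_connected G [set f i | i in 'I_k].
  by apply: contrapT => /disconnected_det d0; rewrite d0 eqxx in detf.
have fT : [set f i | i in 'I_k] \subset T.
  by apply/subsetP => _ /imsetP[i _ ->]; rewrite ffunE enum_valP.
suff -> : T = [set f i | i in 'I_k] by rewrite card_imset ?card_ord.
apply/eqP; rewrite eqEsubset fT andbT; apply/subsetP => e eT.
apply: contrapT => /negP ef.
have [s cs sT] := @cycle_of_connect G _ e (conf _ _) ef.
apply: (acT s cs) => a /sT; rewrite !inE => /predU1P[->//|].
exact: subsetP fT a.
Qed.

(** A repeated edge kills the minor, and an injective family contributes 1 or 0 according to whether
    it forms a tree. As every tree has [k] edges, it is hit by exactly [k!] families, which cancels
    the factor from Cauchy-Binet. *)
Lemma matrix_tree :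
  \det (\matrix_(i, j) \sum_e reduced_incidence int i e * reduced_incidence int j e) =
  (num_spanning_trees G)%:R.
Proof.
have kf : k`!%:R != 0 :> int by rewrite pnatr_eq0 -lt0n fact_gt0.
apply: (mulIf kf); rewrite mulr_natr det_mul_family -natrM.
transitivity (\sum_(f : {ffun 'I_k -> E} |
    injectiveb f && `[< @spanning_tree G [set f i | i in 'I_k] >]) (1 : int)).
  rewrite [RHS]big_mkcond; apply: eq_bigr => f _.
  have [finj|/negP ninj] := boolP (injectiveb f).
    move/injectiveP: finj => finj.
    have [/asboolP|/asboolPn] := boolP `[< _ >] => tf /=.
      rewrite -expr2 connected_det_sqr //.
      by case: tf.
    rewrite disconnected_det ?mul0r // => con; apply: tf.
    exact/spanning_tree_family.
  have /injectivePn[i [j ij fij]] : ~~ injectiveb f by apply/negP.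
  rewrite /= -[X in X * _]det_tr (determinant_alternate ij) ?mul0r // => l.
  by rewrite !mxE fij.
rewrite sumr_const; congr (_ *+ _).
rewrite /num_spanning_trees.
set S := [set T | _].
rewrite -sum1_card (partition_big (fun f : {ffun 'I_k -> E} => [set f i | i in 'I_k])
  (mem S)) /=; last by move=> f /andP[_ tf]; rewrite !inE.
rewrite -sum_nat_const; apply: eq_bigr => T; rewrite inE => /asboolP tT.
rewrite sum1dep_card.
transitivity #|[set f : {ffun 'I_k -> E} in ffun_on (mem T) | injectiveb f]|.
  apply: eq_card => f; rewrite !inE andbC.
  apply/andP/andP => [[/eqP fT /andP[finj _]]|[/ffun_onP fT finjb]].
    by split=> //; apply/ffun_onP => i; rewrite -fT imset_f.
  have /injectiveP finj := finjb.
  have fTE : [set f i | i in 'I_k] = T.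
    apply/eqP; rewrite eqEcard card_imset // card_ord (spanning_tree_card tT) leqnn.
    by rewrite andbT; apply/subsetP => _ /imsetP[i _ ->]; apply: fT.
  rewrite fTE eqxx; split=> //; rewrite unfold_in /=; apply/andP; split=> //.
  by rewrite fTE; apply/asboolP.
apply: etrans (card_inj_ffuns_on _ (mem T)) _; rewrite card_ord.
by rewrite -[X in _ ^_ X](spanning_tree_card tT) ffactnn (spanning_tree_card tT).
Qed.

End MatrixTree.

(** * Trading the reduced Laplacian for the Laplacian plus the all-ones matrix *)

(** A congruence by a matrix [U] of determinant 1 separates the all-ones part from the Gram part,
    leaving diagonal blocks [n ^+ 2] and the reduced Gram matrix. *)
Lemma det_gram_add1 (F : numFieldType) (k : nat) (E : finType)
    (b : 'I_k.+1 -> E -> F) : (forall e, \sum_u b u e = 0) ->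
  \det (\matrix_(u, v) (\sum_e b u e * b v e + 1)) =
  k.+1%:R ^+ 2 * \det (\matrix_(i, j) \sum_e b (lift ord0 i) e * b (lift ord0 j) e).
Proof.
move=> sumb0; pose n : F := k.+1%:R; have n0 : n != 0 by rewrite pnatr_eq0.
(* The first row of U is the all-ones covector, which kills b; the others are
   coordinate covectors minus their mean, which kill the all-ones vector. *)
pose U : 'M[F]_(1 + k) :=
  \matrix_(u, v) if u == ord0 then 1 else (u == v)%:R - n^-1.
have detU : \det U = 1.
  have -> : U = block_mx 1%:M 0 (const_mx (- n^-1)) 1%:M *m
                block_mx 1%:M (const_mx 1) 0 1%:M.
    rewrite mulmx_block !(mul1mx, mul0mx, mulmx1, addr0).
    apply/matrixP => i j; rewrite -(splitK i) -(splitK j).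
    case: (split i) => i0; case: (split j) => j0 /=;
      rewrite ?(block_mxEul, block_mxEur, block_mxEdl, block_mxEdr) !mxE
        ?(ord1 i0) ?(ord1 j0) //=.
      by rewrite sub0r.
    by rewrite big_ord1 !mxE mulr1 addrC -[RHS]/((i0 == j0)%:R - _) -(eq_rshift 1).
  by rewrite det_mulmx det_lblock det_ublock !det1 !mulr1.
have Ub e u : \sum_v U u v * b v e = if u == ord0 then 0 else b u e.
  under eq_bigr do rewrite mxE.
  case: eqP => _; first by under eq_bigr do rewrite mul1r; apply: sumb0.
  under eq_bigr do rewrite mulrBl.
  rewrite sumrB -mulr_sumr sumb0 mulr0 subr0 (bigD1 u) //= eqxx mul1r.
  by rewrite big1 ?addr0 // => v; rewrite eq_sym => /negPf->; rewrite mul0r.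
have U1 u : \sum_v U u v = if u == ord0 then n else 0.
  under eq_bigr do rewrite mxE.
  case: eqP => _; first by rewrite sumr_const card_ord.
  rewrite sumrB (bigD1 u) //= eqxx big1; last first.
    by move=> v; rewrite eq_sym => /negPf->.
  by rewrite sumr_const card_ord addr0 -[n^-1 *+ _]mulr_natr mulVf // subrr.
clearbody U.
set M := (\matrix_(u, v) _ : 'M_k.+1).
set L := (\matrix_(i, j) _ : 'M_k).
have <- : \det (U *m M *m U^T) = \det M.
  by rewrite !det_mulmx det_tr detU mul1r mulr1.
have -> : U *m M *m U^T = block_mx (n ^+ 2)%:M 0 0 L; last first.
  by rewrite det_ublock det_scalar1.
apply/matrixP => i j.
transitivity (\sum_e (if i == ord0 then 0 else b i e) * (if j == ord0 then 0 else b j e)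
   + (if i == ord0 then n else 0) * (if j == ord0 then n else 0)).
  rewrite -!U1; under eq_bigr do rewrite -!Ub.
  rewrite mxE.
  transitivity (\sum_v \sum_u (\sum_e U i u * b u e * (U j v * b v e) + U i u * U j v)).
    apply: eq_bigr => v _; rewrite !mxE big_distrl /=; apply: eq_bigr => u _.
    rewrite mxE mulrDr mulr1 mulrDl mulr_sumr mulr_suml; congr (_ + _).
    by apply: eq_bigr => e _; ring.
  under [LHS]eq_bigr do rewrite big_split /= exchange_big /=.
  rewrite big_split /= exchange_big /=; congr (_ + _).
    apply: eq_bigr => e _; rewrite mulr_sumr; apply: eq_bigr => v _.
    by rewrite mulr_suml.
  by rewrite mulr_sumr; apply: eq_bigr => v _; rewrite mulr_suml.
rewrite -(splitK i) -(splitK j).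
have lsh (i0 : 'I_1) : lshift k i0 = ord0 by apply: val_inj; rewrite (ord1 i0).
have rsh (i0 : 'I_k) : rshift 1 i0 = lift ord0 i0 by apply: val_inj.
case: (split i) => i0; case: (split j) => j0 /=;
  rewrite ?(block_mxEul, block_mxEur, block_mxEdl, block_mxEdr) ?lsh ?rsh !mxE /=.
- by rewrite big1 ?add0r ?(ord1 i0) ?(ord1 j0) //= => e _; rewrite mul0r.
- by rewrite mulr0 addr0 big1 // => e _; rewrite mul0r.
- by rewrite mul0r addr0 big1 // => e _; rewrite mulr0.
- by rewrite mulr0 addr0.
Qed.

Lemma det_incidence_add1 (F : numFieldType) (k : nat) (E : finType)
    (e0 e1 : E -> 'I_k.+1) (G := MGraph e0 e1) :
  \det (\matrix_(u < k.+1, v < k.+1)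
     (\sum_e @incidence F G u e * @incidence F G v e + 1)) =
  k.+1%:R ^+ 2 * (num_spanning_trees G)%:R.
Proof.
have sum_delta (v : 'I_k.+1) : \sum_u (v == u)%:R = 1 :> F.
  by rewrite (bigD1 v) //= eqxx big1 ?addr0 // => u; rewrite eq_sym => /negPf->.
rewrite det_gram_add1 => [|e]; last by rewrite sumrB !sum_delta subrr.
rewrite -[(num_spanning_trees G)%:R](rmorph_nat (intmul 1)) -matrix_tree -det_map_mx.
congr (_ * \det _); apply/matrixP => i j; rewrite !mxE rmorph_sum /=.
apply: eq_bigr => e _.
by rewrite rmorphM /= !rmorphB /= !rmorph_nat.
Qed.

(** * Spectrum of the circulant Laplacian *)

(** For [z ^+ n = 1], the Laplacian eigenvalue of the character sending [u] to [z ^+ u]. *)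
Definition symbol (F : fieldType) (Gam : seq nat) (z : F) : F :=
  \sum_(g <- Gam) (1 - z ^+ g) * (1 - z ^- g).

Lemma sum_expr_unity (F : fieldType) (n : nat) (z : F) :
  z ^+ n = 1 -> \sum_(i < n) z ^+ i = if z == 1 then n%:R else 0.
Proof.
move=> zn; case: eqP => [->|/eqP z1].
  by under eq_bigr do rewrite expr1n; rewrite sumr_const card_ord.
by apply: (mulfI (_ : z - 1 != 0)); rewrite ?subr_eq0 // -subrX1 zn subrr mulr0.
Qed.

Section Circulant.
Variables (F : numFieldType) (m : nat) (Gam : seq nat).
Let n := m.+2.

(** The circulant graph with its vertex type read as ['I_n], to which ['Z_n] reduces for [n = m.+2];
    the results on ordinal vertices then apply. *)
Let e0 (e : 'Z_n * 'I_(size Gam)) : 'I_n := e.1.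
Let e1 (e : 'Z_n * 'I_(size Gam)) : 'I_n := e.1 + (nth 0%N Gam e.2)%:R.
Let G := MGraph e0 e1.

Section Eigenvalue.
Variables (z : F) (zn : z ^+ n = 1).

Let expr_addZ (u v : 'Z_n) : z ^+ (u + v)%R = z ^+ u * z ^+ v.
Proof. by rewrite -exprD -(expr_mod (u + v)%N zn). Qed.

Let expr_natZ (g : nat) : z ^+ (g%:R : 'Z_n) = z ^+ g.
Proof. by rewrite val_Zp_nat // expr_mod. Qed.

Let z0 : z != 0.
Proof. by apply/eqP => z0; move/eqP: zn; rewrite z0 expr0n eq_sym oner_eq0. Qed.

Lemma circulant_eigenvector (u : 'I_n) :
  \sum_v (\sum_e @incidence F G u e * @incidence F G v e + 1) * z ^+ v =
  (symbol Gam z + (if z == 1 then n%:R else 0)) * z ^+ u.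
Proof.
under eq_bigr do rewrite mulrDl mul1r.
rewrite big_split /= sum_expr_unity // mulrDl; congr (_ + _); last first.
  by case: eqP => [->|_]; rewrite ?expr1n ?mulr1 ?mul0r.
under eq_bigr do rewrite mulr_suml.
rewrite exchange_big /=.
have sum_delta (x : 'I_n) : \sum_(v < n) (x == v)%:R * z ^+ v = z ^+ x.
  rewrite (bigD1 x) //= eqxx mul1r big1 ?addr0 // => v.
  by rewrite eq_sym => /negPf->; rewrite mul0r.
transitivity (\sum_e @incidence F G u e * (z ^+ e1 e - z ^+ e0 e)).
  apply: eq_bigr => e _; rewrite -!sum_delta -sumrB mulr_sumr.
  by apply: eq_bigr => v _; rewrite -mulrBl mulrA.
rewrite -(pair_bigA _ (fun x i =>
  @incidence F G u (x, i) * (z ^+ e1 (x, i) - z ^+ e0 (x, i)))) /=.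
rewrite exchange_big /= /symbol (big_nth 0%N) big_mkord mulr_suml.
apply: eq_bigr => i _; set g := nth 0%N Gam i.
(* Among the edges of jump [g], only those based at [u - g] and at [u] meet [u]; the edge based at
   [x] contributes the difference [z ^+ x * (z ^+ g - 1)]. *)
transitivity (\sum_x ((u - g%:R == x)%:R * z ^+ x - (u == x)%:R * z ^+ x) * (z ^+ g - 1)).
  apply: eq_bigr => x _; rewrite /incidence /e1 /e0 /= -/g expr_addZ expr_natZ.
  have -> : (x + g%:R == u) = (u - g%:R == x) by rewrite subr_eq eq_sym.
  by rewrite (eq_sym x u); move: (_ == x)%:R (u == x)%:R => a b; ring.
rewrite -mulr_suml sumrB !sum_delta.
have -> : z ^+ (u - g%:R)%R = z ^+ u * z ^- g.
  by apply: (mulIf (expf_neq0 g z0)); rewrite mulfVK ?expf_neq0 //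
    -[X in _ * X]expr_natZ -expr_addZ subrK.
by move: (z ^- g) => a; ring.
Qed.

End Eigenvalue.

Variable w : F.
Hypothesis prim_w : n.-primitive_root w.

Lemma circulant_spanning_trees :
  n%:R * (num_spanning_trees (circulant n Gam))%:R =
  \prod_(1 <= k < n) symbol Gam (w ^+ k).
Proof.
have n0 : n%:R != 0 :> F by rewrite pnatr_eq0.
pose M : 'M[F]_n := \matrix_(u, v) (\sum_e @incidence F G u e * @incidence F G v e + 1).
pose V := Vandermonde n (\row_(k < n) w ^+ k).
pose D := \row_(k < n) (symbol Gam (w ^+ k) + (if w ^+ k == 1 then n%:R else 0)).
have MV : M *m V = V *m diag_mx D.
  apply/matrixP => u k; rewrite mul_mx_diag !mxE mulrC -circulant_eigenvector.
    by apply: eq_bigr => v _; rewrite !mxE.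
  by rewrite -exprM mulnC exprM (prim_expr_order prim_w) expr1n.
have detV : \det V != 0.
  rewrite det_Vandermonde; apply/prodf_neq0 => i _; apply/prodf_neq0 => j ij.
  rewrite !mxE subr_eq0 (eq_prim_root_expr prim_w) !modn_small //.
  by rewrite neq_ltn ij orbT.
have := congr1 determinant MV; rewrite !det_mulmx mulrC => /(mulfI detV).
rewrite det_incidence_add1 det_diag big_ord_recl /= !mxE expr0 eqxx.
(* The eigenvalue at [k = 0] is [n], coming from the all-ones matrix alone; it cancels one of the
   two factors [n] in [det_incidence_add1]. *)
have -> : symbol Gam (1 : F) = 0.
  by rewrite /symbol big1 // => g _; rewrite expr1n subrr mul0r.
rewrite add0r expr2 -mulrA => /(mulfI n0) ->.
rewrite big_add1 big_mkord; apply: eq_bigr => k _; rewrite mxE lift0.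
by rewrite -(prim_order_dvd prim_w) gtnNdvd ?addr0 // ltnS.
Qed.

End Circulant.

(** * Tree counts through the roots of the reduced symbol *)

Lemma prim_root_exists_closed (C : numClosedFieldType) (n : nat) :
  (0 < n)%N -> exists z : C, n.-primitive_root z.
Proof.
move=> n0; pose p : {poly C} := 'X^n - 1; have [r Dp] := closed_field_poly_normal p.
move: Dp; rewrite (monicP _) ?monicXnsubC // scale1r => Dp.
have rn1 : all n.-unity_root r by apply/allP=> z; rewrite -root_prod_XsubC -Dp.
have sz_r : (n < (size r).+1)%N.
  by rewrite -(size_prod_XsubC r id) -Dp size_XnsubC.
have [|z] := hasP (has_prim_root n0 rn1 _ sz_r); last by exists z.
by rewrite -separable_prod_XsubC -Dp separable_Xn_sub_1 // pnatr_eq0 -lt0n.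
Qed.

(** Both sides are the quotient of [X^n - 1] by [X - 1]; cancelling among polynomials keeps the
    value [x = 1] available. *)
Lemma prod_cyclotomic_roots (F : fieldType) (n : nat) (w x : F) :
  (0 < n)%N -> n.-primitive_root w ->
  \prod_(1 <= k < n) (x - w ^+ k) = \sum_(i < n) x ^+ i.
Proof.
move=> n0 prim_w.
have XnE : \prod_(1 <= k < n) ('X - (w ^+ k)%:P) = \sum_(i < n) 'X^i :> {poly F}.
  apply: (mulfI (negbT (polyXsubC_eq0 (1 : F)))).
  by rewrite -[in RHS]subrX1 -(factor_Xn_sub_1 prim_w) [RHS]big_ltn.
have := congr1 (fun p => p.[x]) XnE; rewrite horner_prod horner_sum.
by under eq_bigr do rewrite hornerXsubC; under [X in _ = X -> _]eq_bigr do rewrite hornerXn.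
Qed.

(** This is Q; [m] is meant to bound the jumps, so that [m - g] is a true subtraction. *)
Definition reduced_symbol (C : comNzRingType) (Gam : seq nat) (m : nat) : {poly C} :=
  \sum_(g <- Gam) 'X^(m - g) * (\sum_(j < g) 'X^j) ^+ 2.

Lemma symbol_reduced (C : fieldType) (Gam : seq nat) (m : nat) (z : C) :
  {in Gam, forall g, (g <= m)%N} -> z != 0 ->
  symbol Gam z * z ^+ m = - (z - 1) ^+ 2 * (reduced_symbol C Gam m).[z].
Proof.
move=> Gam_m z0; rewrite /symbol /reduced_symbol horner_sum mulr_suml mulr_sumr.
apply: eq_big_seq => g /Gam_m gm; rewrite hornerM hornerXn horner_exp horner_sum.
under [X in _ = _ * (_ * X ^+ _)]eq_bigr do rewrite hornerXn.
rewrite mulrCA mulNr -exprMn -subrX1 -{1}(subnK gm) exprD.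
have zg := expf_neq0 g z0.
by field.
Qed.

Lemma reduced_symbol1 (C : fieldType) (Gam : seq nat) (m : nat) :
  (reduced_symbol C Gam m).[1] = \sum_(g <- Gam) g%:R ^+ 2.
Proof.
rewrite horner_sum; apply: eq_bigr => g _.
rewrite hornerM hornerXn horner_exp expr1n mul1r horner_sum.
under eq_bigr do rewrite hornerXn expr1n.
by rewrite sumr_const card_ord.
Qed.

Section NumClosed.
Variables (C : numClosedFieldType) (Gam : seq nat) (m : nat).
Hypotheses (Gam_m : {in Gam, forall g, (g <= m)%N}) (Gam1 : 1%N \in Gam).
Let cGam : C := \sum_(g <- Gam) g%:R ^+ 2.
Let Q := reduced_symbol C Gam m.

Let cGam_gt0 : 0 < cGam.
Proof.
rewrite /cGam (big_rem 1%N) //= expr1n ltr_pwDl ?ltr01 //.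
by apply: sumr_ge0 => g _; rewrite exprn_ge0 ?ler0n.
Qed.

(** On the circle [z ^- g] is the conjugate of [z ^+ g], so the symbol is a sum of squared moduli.
    Its vanishing forces [z = 1] through the jump 1, but there Q takes the value [cGam > 0]. *)
Lemma reduced_symbol_unit_circle (z : C) : `|z| = 1 -> Q.[z] != 0.
Proof.
move=> z1; apply/eqP => Qz.
have z0 : z != 0 by rewrite -normr_eq0 z1 oner_eq0.
have := symbol_reduced Gam_m z0; rewrite -/Q Qz mulr0 => /eqP.
rewrite mulf_eq0 expf_eq0 (negPf z0) andbF orbF.
have -> : symbol Gam z = \sum_(g <- Gam) `|1 - z ^+ g| ^+ 2.
  apply: eq_bigr => g _; rewrite normCK rmorphB rmorph1 rmorphXn /=.
  by rewrite -exprVn invC_norm z1 expr1n invr1 mul1r.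
rewrite psumr_eq0; last by move=> g _; rewrite exprn_ge0.
move=> /allP/(_ _ Gam1); rewrite expf_eq0 normr_eq0 subr_eq0 expr1 => /eqP z1'.
by move: cGam_gt0; rewrite /cGam -(reduced_symbol1 C Gam m) z1' -/Q Qz ltxx.
Qed.

Lemma spanning_trees_roots :
  exists (l : C) (rs : seq C), [/\ l != 0, {in rs, forall r, `|r| != 1} &
    forall n, (1 < n)%N ->
      cGam * (num_spanning_trees (circulant n Gam))%:R =
      n%:R * `|l| ^+ n * \prod_(r <- rs) `|1 - r ^+ n|].
Proof.
have Q0 : Q != 0.
  by apply: contraTneq cGam_gt0 => Q0;
    rewrite /cGam -(reduced_symbol1 C Gam m) -/Q Q0 horner0 ltxx.
have [rs Qrs] := closed_field_poly_normal Q.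
exists (lead_coef Q), rs.
split=> [|r rrs|]; first by rewrite lead_coef_eq0.
  apply/eqP => /reduced_symbol_unit_circle/negP[]; rewrite -/(root Q r) Qrs.
  by rewrite rootZ ?lead_coef_eq0 // root_prod_XsubC.
have normQ z : `|Q.[z]| = `|lead_coef Q| * \prod_(r <- rs) `|z - r|.
  rewrite {1}Qrs hornerZ normrM horner_prod normr_prod; congr (_ * _).
  by apply: eq_bigr => r _; rewrite hornerXsubC.
case=> [|[|m']] // _; set n := m'.+2.
have [w prim_w] := prim_root_exists_closed C (isT : (0 < n)%N).
have n0 : n%:R != 0 :> C by rewrite pnatr_eq0.
have w1 k : `|w ^+ k| = 1.
  rewrite normrX; suff -> : `|w| = 1 by rewrite expr1n.
  apply/eqP; rewrite -(@pexpr_eq1 _ _ n) // -normrX.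
  by rewrite (prim_expr_order prim_w) normr1.
have w0 k : w ^+ k != 0 by rewrite -normr_eq0 w1 oner_eq0.
have prod_abs x : \prod_(1 <= k < n) `|w ^+ k - x| = `|\sum_(i < n) x ^+ i|.
  rewrite -(prod_cyclotomic_roots x _ prim_w) // normr_prod.
  by apply: eq_bigr => k _; rewrite distrC.
(* In the product over [w ^+ k], the factor [(z - 1) ^+ 2] gives [n ^+ 2], while exchanging the
   products over [k] and over the roots evaluates the part coming from Q. *)
have tauE : (num_spanning_trees (circulant n Gam))%:R =
    n%:R * `|lead_coef Q| ^+ n.-1 * \prod_(r <- rs) `|\sum_(i < n) r ^+ i|.
  apply: (mulfI n0).
  rewrite -[LHS]ger0_norm ?mulr_ge0 ?ler0n //
    (circulant_spanning_trees Gam prim_w) normr_prod.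
  transitivity (\prod_(1 <= k < n) (`|w ^+ k - 1| ^+ 2 * `|Q.[w ^+ k]|)).
    apply: eq_bigr => k _.
    have := congr1 (@Num.norm _ C) (symbol_reduced Gam_m (w0 k)).
    move: (w1 k); move: (w ^+ k) => y y1.
    by rewrite !normrM normrN !normrX y1 expr1n mulr1.
  rewrite big_split /= prodrXl prod_abs.
  under [X in `|X|]eq_bigr do rewrite expr1n.
  rewrite sumr_const card_ord ger0_norm ?ler0n //.
  under eq_bigr do rewrite normQ.
  rewrite big_split /= prodr_const_nat subn1 exchange_big /=.
  under [in LHS]eq_bigr do rewrite prod_abs.
  by rewrite expr2 -!mulrA.
rewrite tauE.
(* Writing [cGam] as the modulus of Q(1) supplies the missing factor of [l] and turns each geometric
   sum into [1 - r ^+ n]. *)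
have -> : cGam = `|lead_coef Q| * \prod_(r <- rs) `|1 - r|.
  by rewrite -normQ reduced_symbol1 ger0_norm // ltW.
transitivity (n%:R * `|lead_coef Q| ^+ n *
  (\prod_(r <- rs) `|1 - r| * \prod_(r <- rs) `|\sum_(i < n) r ^+ i|)).
  by rewrite [_ ^+ n]exprS /=; ring.
rewrite -big_split /=; congr (_ * _); apply: eq_bigr => r _.
by rewrite distrC -normrM -subrX1 distrC.
Qed.

End NumClosed.

From mathcomp Require Import all_classical all_reals all_analysis complex.
Import Order.TTheory GRing.Theory Num.Theory.
Import numFieldNormedType.Exports.
Local Open Scope classical_set_scope.
Local Open Scope ring_scope.

(** * Asymptotics of the tree counts *)

Section Limits.
Variable R : realType.
Implicit Types r : R[i].

(** The norm on [R[i]] takes values in [R[i]]; limits are taken with this real version. *)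
Definition cmod r : R := complex.Re `|r|.

Lemma cmodE r : `|r| = (cmod r)%:C%C.
Proof. by rewrite /cmod normc_def. Qed.

Lemma cmod_ge0 r : 0 <= cmod r.
Proof. by rewrite -ler0c -cmodE. Qed.

Lemma cmodX r n : cmod (r ^+ n) = cmod r ^+ n.
Proof. by apply: complexI; rewrite rmorphXn /= -!cmodE normrX. Qed.

Lemma cmodM r s : cmod (r * s) = cmod r * cmod s.
Proof. by apply: complexI; rewrite rmorphM /= -!cmodE normrM. Qed.

Lemma cmod_dist1 r : 1 - cmod r <= cmod (1 - r) <= 1 + cmod r.
Proof.
rewrite -!lecR rmorphB rmorphD rmorph1 /= -!cmodE.
have := lerB_dist (1 : R[i]) r; have := ler_normB (1 : R[i]) r.
by rewrite normr1 => -> ->.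
Qed.

Lemma cvg_cmod_1sub_expr r : cmod r < 1 ->
  (fun n => cmod (1 - r ^+ n)) @ \oo --> (1 : R).
Proof.
move=> r1.
have rn0 : (fun n => cmod r ^+ n) @ \oo --> (0 : R).
  by apply: cvg_expr; rewrite ger0_norm ?cmod_ge0.
apply: (@squeeze_cvgr _ _ _ _ (fun n => 1 - cmod r ^+ n) (fun n => 1 + cmod r ^+ n)).
- by apply: nearW => n; rewrite -cmodX cmod_dist1.
- by rewrite -[X in _ --> X]subr0; apply: cvgB => //; apply: cvg_cst.
- by rewrite -[X in _ --> X]addr0; apply: cvgD => //; apply: cvg_cst.
Qed.

(** When [r] lies outside the unit disc, dividing by the power of its modulus replaces [r] by its
    inverse, which lies inside. *)
Lemma cvg_cmod_normalized r : cmod r != 1 ->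
  (fun n => cmod (1 - r ^+ n) / Num.max 1 (cmod r) ^+ n) @ \oo --> (1 : R).
Proof.
move=> r1; have [lt_r1|le_1r] := ltP (cmod r) 1.
  under eq_fun do rewrite expr1n divr1.
  exact: cvg_cmod_1sub_expr.
have gt_r1 : 1 < cmod r by rewrite lt_neqAle eq_sym r1.
have r0 : r != 0.
  by apply: contraTneq gt_r1 => ->; rewrite /cmod normr0 ltr10.
have rV : cmod r^-1 = (cmod r)^-1.
  by apply: complexI; rewrite fmorphV /= -!cmodE normfV.
have -> : (fun n => cmod (1 - r ^+ n) / cmod r ^+ n) =
          (fun n => cmod (1 - r^-1 ^+ n)).
  apply/funext => n; rewrite -exprVn -rV -cmodX -cmodM mulrBl mul1r exprVn.
  rewrite mulfV ?expf_neq0 //.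
  by apply: complexI; rewrite -!cmodE distrC.
by apply: cvg_cmod_1sub_expr; rewrite rV invf_lt1 // (lt_trans ltr01).
Qed.

Lemma cvg_prod_cmod (rs : seq R[i]) : {in rs, forall r, cmod r != 1} ->
  (fun n => \prod_(r <- rs) (cmod (1 - r ^+ n) / Num.max 1 (cmod r) ^+ n)) @ \oo
    --> (1 : R).
Proof.
elim: rs => [_|r rs IHrs rs1].
  by under eq_fun do rewrite big_nil; apply: cvg_cst.
under eq_fun do rewrite big_cons.
have rs1' : {in rs, forall s, cmod s != 1}.
  by move=> s s_rs; apply: rs1; rewrite inE s_rs orbT.
have r1 : cmod r != 1 by apply: rs1; rewrite mem_head.
by have := cvgM (cvg_cmod_normalized r1) (IHrs rs1'); rewrite mulr1; apply.
Qed.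

(* Comparing consecutive indices gives q = 1. *)
Lemma eq_scaled_expr_cvg1 (K q : R) (s t : nat -> R) :
  s @ \oo --> (1 : R) -> t @ \oo --> (1 : R) ->
  (\forall n \near \oo, K * q ^+ n * t n = s n) -> K = 1.
Proof.
move=> s1 t1 Kq.
have sS : (fun n => s n.+1) @ \oo --> (1 : R) by rewrite (cvg_shiftS s).
have tS : (fun n => t n.+1) @ \oo --> (1 : R) by rewrite (cvg_shiftS t).
have KqS : \forall n \near \oo, K * q ^+ n.+1 * t n.+1 = s n.+1.
  by case: Kq => N _ Kq; exists N => // n /= Nn; apply: Kq => /=; apply: leqW.
have q1 : q = 1.
  have cvg1 : (fun n => s n.+1 * t n) @ \oo --> (1 : R).
    by rewrite -[X in _ --> X]mulr1; apply: cvgM.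
  have cvgq : (fun n => q * (s n * t n.+1)) @ \oo --> q.
    rewrite -[X in _ --> X]mulr1; apply: cvgM; first exact: cvg_cst.
    by rewrite -[X in _ --> X]mulr1; apply: cvgM.
  suff : (fun n => s n.+1 * t n) @ \oo --> q.
    by move=> cvgq1; apply: cvg_unique cvgq1 cvg1.
  apply: cvg_trans cvgq; apply: near_eq_cvg; near=> n.
  have <- : K * q ^+ n * t n = s n by near: n.
  have <- : K * q ^+ n.+1 * t n.+1 = s n.+1 by near: n.
  by rewrite exprS; ring.
suff sK : s @ \oo --> K by apply: cvg_unique sK s1.
have : (fun n => K * t n) @ \oo --> K.
  by rewrite -[X in _ --> X]mulr1; apply: cvgM => //; apply: cvg_cst.
apply: cvg_trans; apply: near_eq_cvg; near=> n.
have <- : K * q ^+ n * t n = s n by near: n.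
by rewrite q1 expr1n mulr1.
Unshelve. all: by end_near. Qed.

Lemma circulant_asymptotics (Gam : seq nat) :
  1%N \in Gam ->
  exists2 rho : R, 0 < rho &
    (fun n => (\sum_(g <- Gam) g%:R ^+ 2) * (num_spanning_trees (circulant n Gam))%:R /
       (n%:R * rho ^+ n)) @ \oo --> (1 : R).
Proof.
move=> Gam1; pose m := (\max_(g <- Gam) g)%N.
have Gam_m : {in Gam, forall g, (g <= m)%N} by move=> g gG; apply: leq_bigmax_seq.
have [l [rs [l0 rs1 tauE]]] := @spanning_trees_roots (R[i]) Gam m Gam_m Gam1.
have l_gt0 : 0 < cmod l by rewrite -ltcR -cmodE normr_gt0.
(* The Mahler measure of the reduced symbol. *)
exists (cmod l * \prod_(r <- rs) Num.max 1 (cmod r)).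
  rewrite mulr_gt0 //.
  by rewrite prodr_gt0 // => r _; rewrite lt_max ltr01.
have rs1' : {in rs, forall r, cmod r != 1}.
  move=> r /rs1; apply: contra => /eqP r1; by rewrite cmodE r1.
apply: cvg_trans (cvg_prod_cmod rs1'); apply: near_eq_cvg; near=> n.
have n1 : (1 < n)%N by near: n; exact: nbhs_infty_gt.
have n0 : n%:R != 0 :> R by rewrite pnatr_eq0 -lt0n ltnW.
have -> : (\sum_(g <- Gam) g%:R ^+ 2) * (num_spanning_trees (circulant n Gam))%:R =
    n%:R * cmod l ^+ n * \prod_(r <- rs) cmod (1 - r ^+ n).
  apply: complexI; rewrite !rmorphM rmorph_prod rmorphXn rmorph_sum !rmorph_nat /=.
  under eq_bigr do rewrite rmorphXn rmorph_nat.
  rewrite tauE // cmodE; congr (_ * _); apply: eq_bigr => r _; exact: cmodE.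
rewrite exprMn mulrA -mulf_div divff ?mul1r; last first.
  by rewrite mulf_neq0 // expf_neq0 // gt_eqF.
by rewrite prodf_div prodrXl.
Unshelve. all: by end_near. Qed.

End Limits.

(** * Comparison with the given sequence *)

Theorem mainTheorem4 (R : realType) (d : nat) (hd : (1 <= d)%N)
  (gamma : d.-1.-tuple nat)
  (hgamma : sorted leq (1%N :: gamma))
  (a : nat -> R) (c phi : R)
  (htau : forall n : nat, (last 1%N gamma <= n./2)%N ->
     (num_spanning_trees (circulant n (1%N :: gamma)))%:R = n%:R * a n ^+ 2)
  (hc : c != 0) (hphi : phi != 0)
  (hasymp : (fun n : nat => a n / (c * phi ^+ n)) @ \oo --> (1 : R)) :
  c ^+ 2 = 1 / (1 + \sum_(i < d.-1) (tnth gamma i)%:R ^+ 2).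
Proof.
have [rho rho0 tau_cvg] := circulant_asymptotics R (mem_head 1%N gamma).
have cE : \sum_(g <- 1%N :: gamma) g%:R ^+ 2 =
    1 + \sum_(i < d.-1) (tnth gamma i)%:R ^+ 2 :> R.
  by rewrite big_cons expr1n big_tuple.
have sqr_cvg : (fun n => (a n / (c * phi ^+ n)) ^+ 2) @ \oo --> (1 : R).
  by rewrite -[X in _ --> X]mulr1; apply: cvgM.
(* Substituting [n * a n ^+ 2] for the tree count makes the normalized count equal to [K * q ^+ n]
   times the square of [a n / (c * phi ^+ n)], with these [K] and [q]. *)
have K1 := @eq_scaled_expr_cvg1 R
  ((1 + \sum_(i < d.-1) (tnth gamma i)%:R ^+ 2) * c ^+ 2)
  (phi ^+ 2 / rho) _ _ tau_cvg sqr_cvg.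
have c_gt0 : 0 < 1 + \sum_(i < d.-1) (tnth gamma i)%:R ^+ 2 :> R.
  by rewrite ltr_pwDl ?ltr01 // sumr_ge0 // => i _; rewrite exprn_ge0.
apply: (mulfI (lt0r_neq0 c_gt0)); rewrite K1 ?mul1r ?mulfV ?lt0r_neq0 //.
near=> n.
have n0 : (0 < n)%N by near: n; exact: nbhs_infty_gt.
have n0' : n%:R != 0 :> R by rewrite pnatr_eq0 -lt0n.
have rho_n : rho ^+ n != 0 by rewrite expf_neq0 // lt0r_neq0.
have phi_n : phi ^+ n != 0 by rewrite expf_neq0.
(* The hypothesis applies as soon as [n] is at least twice the last jump. *)
rewrite htau; last first.
  by rewrite geq_half_double; near: n; exact: nbhs_infty_ge.
rewrite cE exprMn exprVn -exprM mulnC exprM.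
by field; rewrite n0' rho_n phi_n hc.
Unshelve. all: by end_near. Qed.
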